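(* Consider $n\ge 2$ agents in the plane and a stationary target $\bm{x}\in\mathbb{R}^2$, evolving under the target estimator and the controller described in the context. Then for every $i\in\mathcal{V}$ the target estimation error $\tilde{\bm{x}}_i(t)=\hat{\bm{x}}_i(t)-\bm{x}$ converges to zero exponentially fast as $t\to\infty$, i.e. there exist constants $C,\lambda>0$ such that $\|\tilde{\bm{x}}_i(t)\|\le C e^{-\lambda t}$ for all $t\ge 0$.
   Context: Agents: $\mathcal{V}=\{1,\dots,n\}$, $n\ge 2$. Agent $i$ has exactly one neighbor $j=j(i)$: $j=i+1$ if $i<n$, and $j=1$ if $i=n$. Agent $i$ has position $\bm{p}_i(t)\in\mathbb{R}^2$ with $\dot{\bm{p}}_i(t)=\bm{u}_i(t)$. The target position $\bm{x}\in\mathbb{R}^2$ is constant. All agents and the target occupy different locations at $t=0$, and the initial positions are such that no inter-agent collision occurs ($\bm{p}_i(t)\ne\bm{p}_{j}(t)$ for $i\neq j$, $t\ge0$). Measurements: $d_i(t)=\|\bm{x}-\bm{p}_i(t)\|$; $\bm{\varphi}_{iT}(t)=(\bm{x}-\bm{p}_i(t))/d_i(t)$; $\bar{\bm{\varphi}}_{iT}(t)$ is $\bm{\varphi}_{iT}(t)$ rotated clockwise by $\pi/2$; $\bm{\varphi}_{ij}(t)=(\bm{p}_j(t)-\bm{p}_i(t))/\|\bm{p}_j(t)-\bm{p}_i(t)\|$; $\psi_{ij}(t)\in[0,2\pi)$ is the counterclockwise angle from $\bm{\varphi}_{iT}(t)$ to $\bm{\varphi}_{ij}(t)$. Target estimator: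 $\dot{\hat{\bm{x}}}_i(t)=k_{est}\left(\bm{I}_2-\bm{\varphi}_{iT}(t)\bm{\varphi}_{iT}^\top(t)\right)(\bm{p}_i(t)-\hat{\bm{x}}_i(t))$ with $k_{est}>0$. Angle estimate: $\hat\beta_{ij}(t)=2\psi_{ij}(t)-3\pi$ if $\psi_{ij}(t)\ge\pi$, and $\hat\beta_{ij}(t)=2\psi_{ij}(t)+\pi$ otherwise. Controller: $\bm{u}_i(t)=k_c(\hat d_i(t)-d^* )\bm{\varphi}_{iT}(t)+k_\omega(\alpha+\tilde\beta_i(t))\bar{\bm{\varphi}}_{iT}(t)$, where $\hat d_i(t)=\|\bm{p}_i(t)-\hat{\bm{x}}_i(t)\|$, $\tilde\beta_i(t)=\hat\beta_{ij}(t)-\beta_{ij}^*$, $d^*>0$ is the desired circumnavigation radius, $\beta_{ij}^*\in[0,2\pi)$ are the desired angular separations, $k_c,k_\omega>0$, and the constant $\alpha$ satisfies $\alpha-\sup_{i\in\mathcal{V},t\ge0}|\tilde\beta_i(t)|\ge\kappa_\alpha>0$ for some constant $\kappa_\alpha$. Solutions $(\bm{p}_i,\hat{\bm{x}}_i)_{i\in\mathcal{V}}$ are (locally absolutely continuous) functions on $[0,\infty)$ satisfying these equations (for almost every $t$), with all bearing vectors well defined, i.e. $d_i(t)>0$ for all $i$ and $t\ge0$. *)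

(* Defs.v *)
From HB Require Import structures.
From mathcomp Require Import all_boot all_order all_algebra.
From mathcomp Require Import all_classical all_reals all_analysis.
From mathcomp Require Import ring lra.
Set Implicit Arguments.
Unset Strict Implicit.
Unset Printing Implicit Defensive.
Import Order.TTheory GRing.Theory Num.Theory.
Import numFieldNormedType.Exports.
Local Open Scope classical_set_scope.
Local Open Scope ring_scope.

(* The library's norm `|v| on matrices is the sup norm; the Euclidean norm is
   needed here. *)
Definition enorm (R : realType) (v : 'cV[R]_2) : R :=
  Num.sqrt (\sum_i v i 0 ^+ 2).

(* Counterclockwise rotation by the angle a. *)
Definition rot (R : realType) (a : R) (v : 'cV[R]_2) : 'cV[R]_2 :=
  \col_i (if i == 0 then cos a * v 0 0 - sin a * v 1 0
          else sin a * v 0 0 + cos a * v 1 0).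

(* Counterclockwise angle in [0, 2 pi) from the unit vector u to the unit
   vector v; it is well defined by ccw_angle_spec and ccw_angle_unique. *)
Definition ccw_angle (R : realType) (u v : 'cV[R]_2) : R :=
  xget 0 [set a | 0 <= a < 2 * pi /\ v = rot a u].

(* Unit vector from p towards q, meaningful for p <> q. *)
Definition bearing (R : realType) (p q : 'cV[R]_2) : 'cV[R]_2 :=
  (enorm (q - p))^-1 *: (q - p).

Definition abs_continuous (R : realType) (f : R -> 'cV[R]_2) (a b : R) : Prop :=
  forall eps : R, 0 < eps -> exists2 delta : R, 0 < delta &
    forall (m : nat) (s e : 'I_m -> R),
      (forall k, a <= s k /\ s k <= e k /\ e k <= b) ->
      trivIset [set: 'I_m] (fun k => `]s k, e k[%classic) ->
      \sum_k (e k - s k) < delta ->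
      \sum_k enorm (f (e k) - f (s k)) < eps.

Definition loc_abs_continuous (R : realType) (f : R -> 'cV[R]_2) : Prop :=
  forall b : R, 0 < b -> abs_continuous f 0 b.

(* The agents are 'I_n, and ordS is the cyclic successor i + 1 mod n. *)
Definition neighbor (n : nat) (i : 'I_n) : 'I_n := ordS i.

Definition psi (R : realType) (n : nat) (x : 'cV[R]_2)
    (p : 'I_n -> R -> 'cV[R]_2) (i : 'I_n) (t : R) : R :=
  ccw_angle (bearing (p i t) x) (bearing (p i t) (p (neighbor i) t)).

Definition beta_hat (R : realType) (n : nat) (x : 'cV[R]_2)
    (p : 'I_n -> R -> 'cV[R]_2) (i : 'I_n) (t : R) : R :=
  if pi <= psi x p i t then 2 * psi x p i t - 3 * pi
  else 2 * psi x p i t + pi.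

(* betas i is the desired separation between agent i and its neighbor. *)
Definition beta_tilde (R : realType) (n : nat) (x : 'cV[R]_2)
    (betas : 'I_n -> R) (p : 'I_n -> R -> 'cV[R]_2) (i : 'I_n) (t : R) : R :=
  beta_hat x p i t - betas i.

Definition controller (R : realType) (n : nat) (x : 'cV[R]_2)
    (kc komega ds alpha : R) (betas : 'I_n -> R)
    (p xhat : 'I_n -> R -> 'cV[R]_2) (i : 'I_n) (t : R) : 'cV[R]_2 :=
  let phi := bearing (p i t) x in
  let phibar := rot (- (pi / 2)) phi in
  (kc * (enorm (p i t - xhat i t) - ds)) *: phi
  + (komega * (alpha + beta_tilde x betas p i t)) *: phibar.

Definition estimator (R : realType) (n : nat) (x : 'cV[R]_2) (kest : R)
    (p xhat : 'I_n -> R -> 'cV[R]_2) (i : 'I_n) (t : R) : 'cV[R]_2 :=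
  let phi := bearing (p i t) x in
  kest *: ((1%:M - phi *m phi^T) *m (p i t - xhat i t)).

(* Trajectories are functions on the whole line, constrained only on
   [0, +oo[. *)
Definition is_solution (R : realType) (n : nat) (x : 'cV[R]_2)
    (kest kc komega ds alpha : R) (betas : 'I_n -> R)
    (p xhat : 'I_n -> R -> 'cV[R]_2) : Prop :=
  forall i : 'I_n,
    [/\ loc_abs_continuous (p i),
        loc_abs_continuous (xhat i),
        {ae @lebesgue_measure R, forall t : R, 0 <= t ->
          is_derive t 1 (p i)
            (controller x kc komega ds alpha betas p xhat i t)},
        {ae @lebesgue_measure R, forall t : R, 0 <= t ->
          is_derive t 1 (xhat i) (estimator x kest p xhat i t)} &
        forall t : R, 0 <= t -> 0 < enorm (x - p i t)].

Lemma enorm_bearing (R : realType) (p q : 'cV[R]_2) :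
  p <> q -> enorm (bearing p q) = 1.
Proof.
move=> pq; have d0 : enorm (q - p) != 0.
  apply/eqP => d0; apply: pq; apply/esym/subr0_eq.
  move/eqP: d0; rewrite sqrtr_eq0 => h.
  have /eqP : \sum_i (q - p) i 0 ^+ 2 = 0.
    by apply/eqP; rewrite eq_le h sumr_ge0// => i _; exact: sqr_ge0.
  rewrite psumr_eq0 => [/allP z|i _]; last exact: sqr_ge0.
  apply/matrixP => i j; rewrite ord1 [RHS]mxE.
  by have := z i (mem_index_enum i); rewrite /= sqrf_eq0 => /eqP.
rewrite /bearing {1}/enorm.
under eq_bigr do rewrite mxE exprMn.
rewrite -mulr_sumr sqrtrM ?sqr_ge0// sqrtr_sqr ger0_norm ?invr_ge0 ?sqrtr_ge0//.
by rewrite mulVf.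
Qed.

Lemma enorm1E (R : realType) (v : 'cV[R]_2) :
  enorm v = 1 -> v 0 0 ^+ 2 + v 1 0 ^+ 2 = 1.
Proof.
rewrite /enorm !big_ord_recl big_ord0 addr0 => h.
have -> : 1 = lift ord0 ord0 :> 'I_2 by apply/val_inj.
rewrite -[LHS]sqr_sqrtr; first by rewrite h expr1n.
by rewrite addr_ge0// sqr_ge0.
Qed.

Lemma cV2P (R : realType) (u v : 'cV[R]_2) :
  u 0 0 = v 0 0 -> u 1 0 = v 1 0 -> u = v.
Proof.
move=> h0 h1; apply/matrixP => i j; rewrite ord1.
case: i => [[|[|//]] hi].
- by rewrite (_ : Ordinal hi = 0)//; apply/val_inj.
- by rewrite (_ : Ordinal hi = 1)//; apply/val_inj.
Qed.

Lemma ccw_angle_exists (R : realType) (u v : 'cV[R]_2) :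
  enorm u = 1 -> enorm v = 1 ->
  exists a : R, 0 <= a < 2 * pi /\ v = rot a u.
Proof.
move=> /enorm1E u1 /enorm1E v1.
set u0 := u 0 0 in u1 *; set u' := u 1 0 in u1 *.
set v0 := v 0 0 in v1 *; set v' := v 1 0 in v1 *.
pose c := u0 * v0 + u' * v'; pose s := u0 * v' - u' * v0.
have cs1 : c ^+ 2 + s ^+ 2 = 1.
  rewrite -[RHS]mulr1 -{1}u1 -v1 /c /s; ring.
have rotE a : cos a = c -> sin a = s -> v = rot a u.
  move=> ca sa; apply: cV2P; rewrite mxE /= ca sa -/u0 -/u' -/v0 -/v' /c /s.
    by rewrite -[LHS]mulr1 -u1; ring.
  by rewrite -[LHS]mulr1 -u1; ring.
have c1 : -1 <= c <= 1.
  by have s2 := sqr_ge0 s; apply/andP; split; nra.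
have acb := acos_ge0 c1; have acp := acos_lepi c1; have p0 := pi_gt0 R.
have sabs : sin (acos c) = `|s|.
  by rewrite sin_acos// -cs1 addrC addKr sqrtr_sqr.
have [s0|s0] := leP 0 s.
  exists (acos c); split; last by apply: rotE; rewrite ?acosK// sabs ger0_norm.
  by rewrite acb /=; lra.
exists (2 * pi - acos c); split; last first.
  have -> : 2 * pi - acos c = - acos c + pi *+ 2 :> R by rewrite mulr_natl addrC.
  apply: rotE; first by rewrite cosD2pi cosN acosK.
  by rewrite sinD2pi sinN sabs ltr0_norm// opprK.
suff : 0 < acos c by move=> ?; apply/andP; split; lra.
rewrite lt_neqAle acb andbT; apply/eqP => ac0.
by move: sabs; rewrite -ac0 sin0 => /esym/eqP; rewrite normr_eq0 lt_eqF.
Qed.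

Lemma ccw_angle_spec (R : realType) (u v : 'cV[R]_2) :
  enorm u = 1 -> enorm v = 1 ->
  0 <= ccw_angle u v < 2 * pi /\ v = rot (ccw_angle u v) u.
Proof.
move=> u1 v1; have [a ha] := ccw_angle_exists u1 v1.
exact: (@xgetI _ 0 [set a : R | 0 <= a < 2 * pi /\ v = rot a u] a ha).
Qed.

Lemma ccw_angle_unique (R : realType) (u : 'cV[R]_2) (a b : R) :
  enorm u = 1 -> 0 <= a < 2 * pi -> 0 <= b < 2 * pi ->
  rot a u = rot b u -> a = b.
Proof.
wlog ab : a b / b <= a => [W u1 ha hb eab|].
  by case: (leP b a) => [/W|/ltW/W h]; [exact|apply/esym/h].
move=> /enorm1E u1 /andP[a0 a2] /andP[b0 b2] eab.
have := congr1 (fun w : 'cV[R]_2 => w 1 0) eab.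
have := congr1 (fun w : 'cV[R]_2 => w 0 0) eab.
rewrite !mxE /= => e0 e1.
move: u1 e0 e1; set u0 := u 0 0; set u' := u 1 0 => u1 e0 e1.
have ca : cos a = cos b.
  rewrite -[LHS]mulr1 -[RHS]mulr1 -u1.
  have -> : cos a * (u0 ^+ 2 + u' ^+ 2)
    = u0 * (cos a * u0 - sin a * u') + u' * (sin a * u0 + cos a * u') by ring.
  by rewrite e0 e1; ring.
have sa : sin a = sin b.
  rewrite -[LHS]mulr1 -[RHS]mulr1 -u1.
  have -> : sin a * (u0 ^+ 2 + u' ^+ 2)
    = u0 * (sin a * u0 + cos a * u') - u' * (cos a * u0 - sin a * u') by ring.
  by rewrite e0 e1; ring.
have c1 : cos (a - b) = 1.
  by rewrite cosB ca sa -!expr2 cos2Dsin2.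
apply/eqP; rewrite eq_le ab andbT leNgt; apply/negP => blta.
pose w := (a - b) / 2.
have s0 : 0 < sin w by apply: sin_gt0_pi; rewrite /w; lra.
move: c1; have -> : a - b = w + w by rewrite /w; field.
rewrite cosD -!expr2 cos2sin2 => h; have := exprn_gt0 2 s0; lra.
Qed.

(* Main.v *)
Require Import Defs.
From mathcomp Require Import all_boot all_order all_algebra.
From mathcomp Require Import all_classical all_reals all_analysis.
From mathcomp Require Import ring lra.
Import Order.TTheory GRing.Theory Num.Theory.
Import numFieldNormedType.Exports.
Local Open Scope classical_set_scope.
Local Open Scope ring_scope.
Set Implicit Arguments.
Unset Strict Implicit.
Unset Printing Implicit Defensive.

(** Each agent is treated alone. Write q = p - x, w = xhat - x, d = |q|, and let
    a, b be the radial and tangential components of w, so that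
    (|w|^2)' = - 2 kest b^2 and the distance satisfies d' = u for a bounded u.
    The bearing frame rotates at rate v / d, where v lies between two positive
    constants but d may be arbitrarily small, so the rotation rate has no upper
    bound. Weighting the cross term by d removes this singularity:
      (d a b)' = v (a^2 - b^2) + (u - kest d) a b
    with the orientation in which a' = - (v / d) b. Hence
    V = |w|^2 - 2 eps d a b satisfies V' <= - lambda V for small eps, with V
    comparable to |w|^2; no lower bound on d and no averaging over a period is
    needed. As trajectories are only absolutely continuous, V' <= - lambda V
    holds almost everywhere, and is integrated by covering the exceptional null
    set by an open set of small measure and chaining along the time axis. *)

(** * Absolutely continuous real functions *)

Definition ac_on (R : realType) (f : R -> R) (a b : R) : Prop :=
  forall eps : R, 0 < eps -> exists2 delta : R, 0 < delta &
    forall (m : nat) (s e : 'I_m -> R),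
      (forall k, a <= s k /\ s k <= e k /\ e k <= b) ->
      trivIset [set: 'I_m] (fun k => `]s k, e k[%classic) ->
      \sum_k (e k - s k) < delta ->
      \sum_k `|f (e k) - f (s k)| < eps.

(** Reduces every closure property below to an estimate on single increments. *)
Lemma ac_on_dominated2 (R : realType) (f g h : R -> R) (M a b : R) :
  0 <= M -> ac_on f a b -> ac_on g a b ->
  (forall s e, a <= s -> s <= e -> e <= b ->
     `|h e - h s| <= M * (`|f e - f s| + `|g e - g s|)) ->
  ac_on h a b.
Proof.
move=> M0 acf acg dom eps eps0.
(* [M + 1] rather than [M] allows [M = 0] and leaves room for a strict inequality. *)
pose eta := eps / (2 * (M + 1)).
have eta0 : 0 < eta by rewrite divr_gt0// mulr_gt0//; lra.
have [df df0 hf] := acf eta eta0; have [dg dg0 hg] := acg eta eta0.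
exists (Num.min df dg); first by rewrite lt_min df0.
move=> m s e se tI; rewrite lt_min => /andP[lf lg].
have := hf _ _ _ se tI lf; have := hg _ _ _ se tI lg => Hg Hf.
apply: (@le_lt_trans _ _
  (M * (\sum_k `|f (e k) - f (s k)| + \sum_k `|g (e k) - g (s k)|))).
  rewrite -big_split/= mulr_sumr; apply: ler_sum => k _.
  by have [? [? ?]] := se k; exact: dom.
apply: (@le_lt_trans _ _ (M * (eta + eta))).
  by apply: ler_wpM2l => //; apply: lerD; exact: ltW.
have -> : eps = (M + 1) * (eta + eta) by rewrite /eta; field; lra.
by rewrite ltr_pM2r ?addr_gt0//; lra.
Qed.

Lemma ac_on_dominated (R : realType) (f h : R -> R) (M a b : R) :
  0 <= M -> ac_on f a b ->
  (forall s e, a <= s -> s <= e -> e <= b ->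
     `|h e - h s| <= M * `|f e - f s|) ->
  ac_on h a b.
Proof.
move=> M0 acf dom; apply: (ac_on_dominated2 M0 acf acf) => s e ? ? ?.
apply: le_trans (dom s e _ _ _) _ => //.
by rewrite ler_wpM2l// lerDl.
Qed.

Lemma ac_on_id (R : realType) (a b : R) : ac_on id a b.
Proof.
move=> eps eps0; exists eps => // m s e se _ lt.
rewrite (eq_bigr (fun k => e k - s k))// => k _.
by rewrite ger0_norm// subr_ge0; have [_ []] := se k.
Qed.

Lemma ac_on_cst (R : realType) (c a b : R) : ac_on (fun=> c) a b.
Proof.
apply: (@ac_on_dominated _ _ _ 0 _ _ _ (ac_on_id a b)) => // s e _ _ _.
by rewrite subrr normr0 mul0r.
Qed.

Lemma ac_onD (R : realType) (f g : R -> R) (a b : R) :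
  ac_on f a b -> ac_on g a b -> ac_on (fun t => f t + g t) a b.
Proof.
move=> acf acg; apply: (ac_on_dominated2 _ acf acg) => [|s e _ _ _].
  exact: ler01.
by rewrite mul1r opprD addrACA ler_normD.
Qed.

Lemma ac_onB (R : realType) (f g : R -> R) (a b : R) :
  ac_on f a b -> ac_on g a b -> ac_on (fun t => f t - g t) a b.
Proof.
move=> acf acg; apply: (ac_on_dominated2 _ acf acg) => [|s e _ _ _].
  exact: ler01.
rewrite mul1r -(normrN (g e - _)).
have -> : f e - g e - (f s - g s) = (f e - f s) + - (g e - g s) by ring.
exact: ler_normD.
Qed.

Lemma ac_on_within_continuous (R : realType) (f : R -> R) (a b : R) :
  ac_on f a b -> {within `[a, b], continuous f}.
Proof.
move=> acf; apply/subspace_continuousP => x /=; rewrite in_itv/= => /andP[ax xb].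
apply/cvgrPdist_lt => eps eps0; have [d d0 hd] := acf eps eps0.
rewrite near_withinE; apply/nbhs_ballP; exists d => //= y.
rewrite /ball/= in_itv/= => xy /andP[ay yb].
wlog le : x y ax xb ay yb xy / x <= y.
  move=> W; case: (leP x y) => [|/ltW]; first exact: W.
  by move=> yx; rewrite distrC W// distrC.
(* A family of one interval already gives uniform continuity. *)
have := hd 1%N (fun=> x) (fun=> y); rewrite !big_ord1 distrC; apply => //.
- by move=> i j _ _ _; rewrite !ord1.
- by rewrite distrC ger0_norm ?subr_ge0 // in xy.
Qed.

Lemma ac_on_bounded (R : realType) (f : R -> R) (a b : R) : a <= b ->
  ac_on f a b -> exists M, 0 <= M /\ forall t, a <= t -> t <= b -> `|f t| <= M.
Proof.
move=> ab /ac_on_within_continuous cf.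
have [c _ hc] := EVT_max ab cf; have [d _ hd] := EVT_min ab cf.
exists (`|f c| + `|f d|); split=> [|t at_ tb]; first by rewrite addr_ge0.
have tI : t \in `[a, b] by rewrite in_itv/= at_.
have := hc _ tI; have := hd _ tI => h1 h2.
have := ler_norm (f c); have := ler_norm (- f d); rewrite normrN => h3 h4.
have := normr_ge0 (f c); have := normr_ge0 (f d) => h5 h6.
by rewrite ler_norml; apply/andP; split; lra.
Qed.

(** Both factors are bounded on the compact interval, so the increment of the product is dominated
    by theirs. *)
Lemma ac_onM (R : realType) (f g : R -> R) (a b : R) : a <= b ->
  ac_on f a b -> ac_on g a b -> ac_on (fun t => f t * g t) a b.
Proof.
move=> ab acf acg.
have [M [M0 hM]] := ac_on_bounded ab acf.
have [N [N0 hN]] := ac_on_bounded ab acg.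
apply: (ac_on_dominated2 (addr_ge0 M0 N0) acf acg) => s e as_ se eb.
have -> : f e * g e - f s * g s = f e * (g e - g s) + g s * (f e - f s) by ring.
rewrite (le_trans (ler_normD _ _))// !normrM.
have h1 : `|f e| <= M by apply: hM => //; exact: le_trans se.
have h2 : `|g s| <= N by apply: hN => //; exact: le_trans eb.
have := normr_ge0 (f e - f s); have := normr_ge0 (g e - g s).
have := normr_ge0 (f e); have := normr_ge0 (g s).
nra.
Qed.

Lemma ac_on_lower_bound (R : realType) (f : R -> R) (a b : R) : a <= b ->
  ac_on f a b -> (forall t, a <= t -> t <= b -> 0 < f t) ->
  exists2 m, 0 < m & forall t, a <= t -> t <= b -> m <= f t.
Proof.
move=> ab /ac_on_within_continuous cf f0; have [c] := EVT_min ab cf.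
rewrite in_itv/= => /andP[ac cb] hc; exists (f c); first exact: f0.
by move=> t at_ tb; apply: hc; rewrite in_itv/= at_.
Qed.

(** By compactness [f] stays above some [m > 0], and inversion is Lipschitz with constant [m ^- 2]
    there. The square root is handled in the same way. *)
Lemma ac_onV (R : realType) (f : R -> R) (a b : R) : a <= b ->
  ac_on f a b -> (forall t, a <= t -> t <= b -> 0 < f t) ->
  ac_on (fun t => (f t)^-1) a b.
Proof.
move=> ab acf f0; have [m m0 hm] := ac_on_lower_bound ab acf f0.
apply: (@ac_on_dominated _ _ _ (m ^- 2) _ _ _ acf).
  by rewrite invr_ge0 exprn_ge0// ltW.
move=> s e as_ se eb.
have hs : m <= f s by apply: hm => //; exact: le_trans eb.
have he : m <= f e by apply: hm => //; exact: le_trans se.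
have s0 : 0 < f s by lra.
have e0 : 0 < f e by lra.
have -> : (f e)^-1 - (f s)^-1 = - ((f e * f s)^-1 * (f e - f s)).
  by field; rewrite !gt_eqF.
rewrite normrN normrM ler_wpM2r// gtr0_norm ?invr_gt0 ?mulr_gt0//.
by rewrite lef_pV2 ?posrE ?mulr_gt0 ?exprn_gt0// expr2 ler_pM// ltW.
Qed.

Lemma ac_on_sqrt (R : realType) (f : R -> R) (a b : R) : a <= b ->
  ac_on f a b -> (forall t, a <= t -> t <= b -> 0 < f t) ->
  ac_on (fun t => Num.sqrt (f t)) a b.
Proof.
move=> ab acf f0; have [m m0 hm] := ac_on_lower_bound ab acf f0.
apply: (@ac_on_dominated _ _ _ (Num.sqrt m)^-1 _ _ _ acf).
  by rewrite invr_ge0 sqrtr_ge0.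
move=> s e as_ se eb.
have hs : m <= f s by apply: hm => //; exact: le_trans eb.
have he : m <= f e by apply: hm => //; exact: le_trans se.
have s0 : 0 <= f s by lra.
have e0 : 0 <= f e by lra.
rewrite -{2}(sqr_sqrtr s0) -{2}(sqr_sqrtr e0) subr_sqr normrM mulrCA.
rewrite ler_peMr//.
have rm : 0 < Num.sqrt m by rewrite sqrtr_gt0.
rewrite mulrC ler_pdivlMr// mul1r ger0_norm ?addr_ge0 ?sqrtr_ge0//.
by rewrite (le_trans (ler_wsqrtr he))// lerDl sqrtr_ge0.
Qed.

Lemma ac_on_expRM (R : realType) (c a b : R) :
  ac_on (fun t => expR (c * t)) a b.
Proof.
pose M := expR (`|c| * (`|a| + `|b|)).
apply: (@ac_on_dominated _ _ _ (M * `|c|) _ _ _ (ac_on_id a b)) => [|s e as_ se eb].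
  by rewrite mulr_ge0// expR_ge0.
have bound t : a <= t -> t <= b -> expR (c * t) <= M.
  move=> at_ tb; rewrite ler_expR (le_trans (ler_norm _))// normrM ler_wpM2l//.
  have := ler_norm b; have := ler_norm (- a); rewrite normrN => h1 h2.
  have := normr_ge0 a; have := normr_ge0 b => h3 h4.
  by rewrite ler_norml; apply/andP; split; lra.
(* Convexity: the graph of [expR] lies above its tangent at [v]. *)
have lip (u v : R) : expR v - expR u <= expR v * (v - u).
  have := expR_ge1Dx (u - v); rewrite expRB.
  rewrite ler_pdivlMr ?expR_gt0//; nra.
have lip' (u v : R) : expR v <= M -> expR v - expR u <= M * `|v - u|.
  move=> vM; apply: le_trans (lip u v) _.
  apply: (@le_trans _ _ (expR v * `|v - u|)); last exact: ler_wpM2r.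
  by apply: ler_wpM2l (ler_norm _); exact: expR_ge0.
have -> : M * `|c| * `|id e - id s| = M * `|c * e - c * s|.
  by rewrite -mulrBr normrM mulrA.
have hs := bound s as_ (le_trans se eb).
have he := bound e (le_trans as_ se) eb.
rewrite ler_norml -[- _ <= _]lerN2 opprK opprB; apply/andP; split; last exact: lip'.
by rewrite distrC; exact: lip'.
Qed.

(** * Monotonicity from the sign of the derivative almost everywhere *)

(* Cousin's lemma, in the form of a supremum argument: [a, b] is cut into
   intervals on which f grows at rate at most eps, and intervals inside U. *)
Lemma straddle_sum_le (R : realType) (f : R -> R) (a b eps : R) (U : set R) :
  a <= b -> 0 <= eps ->
  (forall c, a <= c -> c <= b -> exists2 r, 0 < r &
     forall u v, c - r < u -> u <= c -> c <= v -> v < c + r ->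
       f v - f u <= eps * (v - u) \/ `]u, v[%classic `<=` U) ->
  exists m, exists s e : 'I_m -> R,
    [/\ forall k, a <= s k /\ s k <= e k /\ e k <= b,
        trivIset [set: 'I_m] (fun k => `]s k, e k[%classic),
        forall k, `]s k, e k[%classic `<=` U &
        f b - f a <= eps * (b - a) + \sum_k `|f (e k) - f (s k)|].
Proof.
move=> ab eps0 loc.
pose P c := exists m, exists s e : 'I_m -> R,
    [/\ forall k, a <= s k /\ s k <= e k /\ e k <= c,
        trivIset [set: 'I_m] (fun k => `]s k, e k[%classic),
        forall k, `]s k, e k[%classic `<=` U &
        f c - f a <= eps * (c - a) + \sum_k `|f (e k) - f (s k)|].
change (P b).
have Pa : P a.
  exists 0%N, (fun=> a), (fun=> a); split.
  - by case.
  - by case.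
  - by case.
  - by rewrite big_ord0 !subrr mulr0 addr0.
(* A decomposition up to [c] extends to [z]: a piece of slow growth goes into the [eps] term, a
   piece inside [U] joins the family at index [ord0]. *)
have Pext c z : a <= c -> c <= z -> P c ->
    f z - f c <= eps * (z - c) \/ `]c, z[%classic `<=` U -> P z.
  move=> ac cz [m [s [e [se tI sU fc]]]] [fl|cU].
    exists m, s, e; split => //.
      by move=> k; have [? [? ?]] := se k; split=> //; split=> //; lra.
    have -> : f z - f a = (f z - f c) + (f c - f a) by ring.
    by lra.
  pose s' (k : 'I_m.+1) := if unlift ord0 k is Some j then s j else c.
  pose e' (k : 'I_m.+1) := if unlift ord0 k is Some j then e j else z.
  have disj j x : s j < x < e j -> c < x < z -> False.
    move=> /andP[_ xe] /andP[cx _].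
    by have [_ [_ ?]] := se j; lra.
  exists m.+1, s', e'; split.
  - move=> k; rewrite /s' /e'; case: unliftP => [j _|_]; last by [].
    by have [? [? ?]] := se j; split=> //; split=> //; lra.
  - move=> k l _ _; rewrite /s' /e'.
    case: unliftP => [j ->|->]; case: unliftP => [j' ->|->] //.
    + by move=> ne; congr (lift _ _); apply: tI ne.
    + by move=> [x [/=]]; rewrite !in_itv/= => h1 h2; case: (disj j x).
    + by move=> [x [/=]]; rewrite !in_itv/= => h1 h2; case: (disj j' x).
  - by move=> k; rewrite /s' /e'; case: unliftP.
  - rewrite big_ord_recl /s' /e' unlift_none.
    under eq_bigr do rewrite liftK.
    have := ler_norm (f z - f c).
    have -> : f z - f a = (f z - f c) + (f c - f a) by ring.
    have : eps * (c - a) <= eps * (z - a) by apply: ler_wpM2l => //; lra.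
    lra.
pose S := [set c | a <= c /\ c <= b /\ P c].
have supS : has_sup S.
  by split; [exists a|exists b => c [_ []]].
pose c0 := sup S.
have ac0 : a <= c0 by apply: sup_upper_bound.
have c0b : c0 <= b by apply: ge_sup => [|c [_ []]//]; exists a.
have [r r0 hr] := loc c0 ac0 c0b.
have [u [au [ub Pu]] c0u] := sup_adherent r0 supS.
have uc0 : u <= c0 by apply: sup_upper_bound.
(* Going from [u] to [v] jumps over the supremum [c0]; [v <= c0] then forces [v = b], since
   [c0 + r / 2] exceeds [c0]. *)
pose v := Num.min b (c0 + r / 2).
have c0v : c0 <= v by rewrite le_min c0b/=; lra.
have vr : v < c0 + r by rewrite gt_min; apply/orP; right; lra.
have Pv : P v by apply: (Pext u) => //; [lra|exact: hr].
have vb : v <= b by rewrite ge_min lexx.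
have : v <= c0 by apply: sup_upper_bound => //; split=> //; lra.
rewrite /v ge_min => /orP[bc0|]; last by lra.
by have <- : v = b by apply/eqP; rewrite eq_le vb; lra.
Qed.

Lemma sum_lengths_lt (R : realType) (m : nat) (s e : 'I_m -> R) (U : set R)
    (delta : R) :
  (forall k, s k <= e k) ->
  trivIset [set: 'I_m] (fun k => `]s k, e k[%classic) ->
  (forall k, `]s k, e k[%classic `<=` U) ->
  measurable U -> (lebesgue_measure U < delta%:E)%E ->
  \sum_k (e k - s k) < delta.
Proof.
move=> se tI sU mU Ud; rewrite -lte_fin; apply: le_lt_trans Ud.
have -> : ((\sum_k (e k - s k))%:E = \sum_k lebesgue_measure `]s k, e k[%classic)%E.
  rewrite -sumEFin; apply: eq_bigr => k _.
  rewrite lebesgue_measure_itv/= lte_fin lt_neqAle se andbT.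
  by case: eqVneq => //= ->; rewrite subrr.
rewrite (_ : (\sum_k _)%E =
    lebesgue_measure (\bigcup_(k in [set: 'I_m]) `]s k, e k[%classic)); last first.
  rewrite measure_fin_bigcup//; last exact: finite_finset.
  rewrite (fsbigE (index_enum 'I_m)) ?index_enum_uniq//.
    by apply: eq_bigl => k; rewrite in_setT.
  by move=> k _; rewrite mem_index_enum.
apply: le_measure; rewrite ?inE//.
  by apply: fin_bigcup_measurable => //; exact: finite_finset.
by move=> x [k _]; exact: sU.
Qed.

(** Splitting the increment at [t] leaves two one-sided difference quotients, both below [eps] near
    [t] because they tend to [df <= 0]. *)
Lemma is_derive_npos_straddle (R : realType) (f : R -> R) (t df eps : R) :
  is_derive t 1 f df -> df <= 0 -> 0 < eps ->
  exists2 r, 0 < r & forall u v, t - r < u -> u <= t -> t <= v -> v < t + r ->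
    f v - f u <= eps * (v - u).
Proof.
move=> [dvf dfE] df0 eps0.
have cv : h^-1 *: (f (h *: (1 : R) + t) - f t) @[h --> 0^'] --> df.
  by rewrite -dfE; exact: dvf.
have /= [r /= r0 hr] := cvgr_lt _ cv _ (le_lt_trans df0 eps0).
have slope w : `|w - t| < r -> w != t -> (w - t)^-1 * (f w - f t) < eps.
  move=> wr wt; have := hr (w - t).
  rewrite /ball/= sub0r normrN => /(_ wr); rewrite subr_eq0 => /(_ wt).
  by rewrite [_%:A]mulr1 subrK.
exists r => // u v tu ut tv vt.
have fv : f v - f t <= eps * (v - t).
  have [->|vt'] := eqVneq v t; first by rewrite !subrr mulr0.
  have vt0 : 0 < v - t by rewrite subr_gt0 lt_neqAle eq_sym vt'.
  have := slope v; rewrite gtr0_norm// => /(_ _ vt') h.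
  rewrite -ler_pdivrMr// mulrC ltW// h//; lra.
have fu : f t - f u <= eps * (t - u).
  have [->|ut'] := eqVneq u t; first by rewrite !subrr mulr0.
  have ut0 : 0 < t - u by rewrite subr_gt0 lt_neqAle ut'.
  have := slope u; rewrite distrC gtr0_norm// => /(_ _ ut') h.
  have E : (u - t)^-1 * (f u - f t) = (f t - f u) / (t - u).
    by rewrite -(opprB t u) invrN mulNr -mulrN opprB mulrC.
  rewrite -ler_pdivrMr// -E ltW// h//; lra.
have -> : f v - f u = (f v - f t) + (f t - f u) by ring.
lra.
Qed.

(** The exceptional null set is enclosed in an open [U] of measure below [delta]. Absolute
    continuity bounds the total variation over the pieces inside [U], and the derivative controls
    the remaining ones. *)
Lemma ac_on_nonincreasing (R : realType) (f : R -> R) (a b : R) :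
  a <= b -> ac_on f a b ->
  {ae @lebesgue_measure R, forall t : R, a <= t ->
     exists2 df, is_derive t 1 f df & df <= 0} ->
  f b <= f a.
Proof.
move=> ab acf [N [mN N0' badN]].
have N0 : lebesgue_measure N = 0%E := N0'.
rewrite -subr_le0; apply/ler_addgt0Pl => eps eps0; rewrite addr0.
(* Budget: [eta * (b - a)] for the pieces of slow growth, [eta] for those inside [U]. *)
pose eta := eps / (b - a + 1).
have eta0 : 0 < eta by rewrite divr_gt0//; lra.
have [delta delta0 hd] := acf eta eta0.
have [U [oU NU UN]] : exists U : set R,
    [/\ open U, N `<=` U & (lebesgue_measure (U `\` N) < delta%:E)%E].
  have Noo : (lebesgue_measure N < +oo)%E by rewrite N0 ltry.
  exact: lebesgue_regularity_outer.
have mU : measurable U by exact: measurable_realfun.open_measurable.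
(* Outer regularity bounds [U] minus [N] only; adding back the null set [N] changes nothing. *)
have Ud : (lebesgue_measure U < delta%:E)%E.
  have mUN : measurable (U `\` N) by exact: measurableD.
  have mUU : measurable (U `\` N `|` N) by exact: measurableU.
  have UE : lebesgue_measure (U `\` N `|` N) = lebesgue_measure (U `\` N).
    exact: measureU0.
  apply: le_lt_trans UN; rewrite -UE.
  apply: le_measure; rewrite ?inE// => x Ux.
  by have [Nx|Nx] := pselect (N x); [right|left].
have [|m [s [e [se tI sU fab]]]] := @straddle_sum_le _ f a b eta U ab (ltW eta0).
  move=> c ac cb; have [Uc|Uc] := pselect (U c).
    have /nbhs_ballP[r /= r0 hr] : nbhs c U by exact: open_nbhs_nbhs.
    exists r => // u v cu uc cv vc; right=> y /=; rewrite in_itv/= => /andP[uy yv].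
    by apply: hr; rewrite /ball/= distrC ltr_distl; apply/andP; split; lra.
  have [df dff df0] : exists2 df, is_derive c 1 f df & df <= 0.
    have [//|bad] := pselect (exists2 df, is_derive c 1 f df & df <= 0).
    by case: Uc; apply/NU/badN => /(_ ac).
  have [r r0 hr] := is_derive_npos_straddle dff df0 eta0.
  by exists r => // u v *; left; exact: hr.
have sumd : \sum_k (e k - s k) < delta.
  by apply: (sum_lengths_lt _ tI sU mU Ud) => k; have [_ []] := se k.
have := hd _ _ _ se tI sumd.
have -> : eps = eta * (b - a + 1) by rewrite /eta; field; lra.
lra.
Qed.

(** * Derivation rules and a Gronwall inequality *)

#[local] Instance ae_lebesgue_filter (R : realType) :
  Filter (nbhs (almost_everywhere (@lebesgue_measure R))).
Proof. exact: (ae_filter_ringOfSetsType (@lebesgue_measure R)). Qed.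

Lemma is_derive1D (R : realType) (f g : R -> R) (t df dg : R) :
  is_derive t 1 f df -> is_derive t 1 g dg ->
  is_derive t 1 (fun s => f s + g s) (df + dg).
Proof. exact: is_deriveD. Qed.

Lemma is_derive1B (R : realType) (f g : R -> R) (t df dg : R) :
  is_derive t 1 f df -> is_derive t 1 g dg ->
  is_derive t 1 (fun s => f s - g s) (df - dg).
Proof. exact: is_deriveB. Qed.

Lemma is_derive1M (R : realType) (f g : R -> R) (t df dg : R) :
  is_derive t 1 f df -> is_derive t 1 g dg ->
  is_derive t 1 (fun s => f s * g s) (f t * dg + g t * df).
Proof. exact: is_deriveM. Qed.

Lemma is_derive1V (R : realType) (f : R -> R) (t df : R) :
  f t != 0 -> is_derive t 1 f df ->
  is_derive t 1 (fun s => (f s)^-1) (- f t ^- 2 * df).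
Proof.
move=> ft0 [dvf dfE]; apply: DeriveDef; first exact: derivableV.
by rewrite deriveV// dfE.
Qed.

Lemma is_derive1_sqrt_comp (R : realType) (f : R -> R) (t df : R) :
  0 < f t -> is_derive t 1 f df ->
  is_derive t 1 (fun s => Num.sqrt (f s)) ((2 * Num.sqrt (f t))^-1 * df).
Proof. by move=> ft0 dff; apply: is_derive1_comp; exact: is_derive1_sqrt. Qed.

(** With the integrating factor, [f t * expR (c * t)] has nonpositive derivative almost everywhere.
    The case [c = 0] gives plain monotonicity. *)
Lemma ac_gronwall (R : realType) (f : R -> R) (c : R) :
  (forall b, 0 < b -> ac_on f 0 b) ->
  {ae @lebesgue_measure R, forall t : R, 0 <= t ->
     exists2 df, is_derive t 1 f df & df <= - c * f t} ->
  forall t, 0 <= t -> f t <= f 0 * expR (- c * t).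
Proof.
move=> acf aef t; rewrite le_eqVlt => /orP[/eqP<-|t0].
  by rewrite mulr0 expR0 mulr1.
suff : f t * expR (c * t) <= f 0 * expR (c * 0).
  by rewrite mulr0 expR0 mulr1 mulNr expRN ler_pdivlMr ?expR_gt0.
apply: (@ac_on_nonincreasing _ (fun s => f s * expR (c * s)) 0 t) => //.
  exact: ltW.
  by apply: ac_onM; [exact: ltW|exact: acf|exact: ac_on_expRM].
apply: filterS aef => s + s0 => /(_ s0)[df dfs dfc].
exists (f s * (c * expR (c * s)) + expR (c * s) * df).
  have dc : is_derive s 1 (fun s => c * s) c.
    apply: (is_derive_eq (is_derive1M (is_derive_cst c s 1) (is_derive_id s 1))).
    by rewrite mulr1 mulr0 addr0.
  have de := @is_derive1_comp _ expR (fun s => c * s) s _ _ (is_derive_expR _) dc.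
  apply: (is_derive_eq (is_derive1M dfs de)).
  by rewrite [expR _ * c]mulrC.
have := expR_gt0 (c * s); nra.
Qed.

(** * The error dynamics of a single agent *)

Lemma sqrt_sum2_triangle (R : realType) (x0 x1 y0 y1 : R) :
  Num.sqrt ((x0 + y0) ^+ 2 + (x1 + y1) ^+ 2) <=
  Num.sqrt (x0 ^+ 2 + x1 ^+ 2) + Num.sqrt (y0 ^+ 2 + y1 ^+ 2).
Proof.
have X0 : 0 <= x0 ^+ 2 + x1 ^+ 2 by rewrite addr_ge0 ?sqr_ge0.
have Y0 : 0 <= y0 ^+ 2 + y1 ^+ 2 by rewrite addr_ge0 ?sqr_ge0.
have cs : x0 * y0 + x1 * y1 <=
    Num.sqrt (x0 ^+ 2 + x1 ^+ 2) * Num.sqrt (y0 ^+ 2 + y1 ^+ 2).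
  rewrite -sqrtrM// (le_trans (ler_norm _))// -sqrtr_sqr ler_wsqrtr//.
  (* Lagrange's identity: the gap in the Cauchy-Schwarz inequality is this square. *)
  by rewrite -subr_ge0; have := sqr_ge0 (x0 * y1 - x1 * y0); lra.
rewrite -[leRHS]ger0_norm ?addr_ge0 ?sqrtr_ge0// -sqrtr_sqr ler_wsqrtr//.
have := sqr_sqrtr X0; have := sqr_sqrtr Y0; move: cs.
set a := Num.sqrt _; set b := Num.sqrt _; nra.
Qed.

(* Here q and w are p - x and xhat - x, and v stands for the angular gain
   komega * (alpha + beta_tilde), of which only the bounds cm and cM matter. *)
Definition planar_flow (R : realType) (k kc ds cm cM : R)
    (q0 q1 w0 w1 : R -> R) : Prop :=
  [/\ forall b, 0 < b ->
        [/\ ac_on q0 0 b, ac_on q1 0 b, ac_on w0 0 b & ac_on w1 0 b],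
      forall t, 0 <= t -> 0 < q0 t ^+ 2 + q1 t ^+ 2 &
      {ae @lebesgue_measure R, forall t : R, 0 <= t ->
        exists v,
        let d := Num.sqrt (q0 t ^+ 2 + q1 t ^+ 2) in
        let u := - kc *
          (Num.sqrt ((q0 t - w0 t) ^+ 2 + (q1 t - w1 t) ^+ 2) - ds) in
        let z := k * (q0 t * w1 t - q1 t * w0 t) / d ^+ 2 in
        (cm <= v <= cM) /\
        [/\ is_derive t 1 q0 ((u * q0 t - v * q1 t) / d),
            is_derive t 1 q1 ((u * q1 t + v * q0 t) / d),
            is_derive t 1 w0 (z * q1 t) &
            is_derive t 1 w1 (- z * q0 t)]}].

(** The estimator only damps the component of [w] normal to [q]: the derivative of the squared error
    is [- 2 k] times the square of that component. *)
Lemma planar_flow_error_le (R : realType) (k kc ds cm cM : R)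
    (q0 q1 w0 w1 : R -> R) : 0 < k ->
  planar_flow k kc ds cm cM q0 q1 w0 w1 ->
  forall t, 0 <= t -> w0 t ^+ 2 + w1 t ^+ 2 <= w0 0 ^+ 2 + w1 0 ^+ 2.
Proof.
move=> k0 [acqw Q0 aeqw] t t0.
have -> : w0 0 ^+ 2 + w1 0 ^+ 2 =
    (w0 0 * w0 0 + w1 0 * w1 0) * expR (- 0 * t).
  by rewrite oppr0 mul0r expR0 mulr1.
apply: (@ac_gronwall _ (fun s => w0 s * w0 s + w1 s * w1 s)) t t0.
  move=> b b0; have [_ _ ac0 ac1] := acqw b b0.
  by apply: ac_onD; apply: ac_onM => //; exact: ltW.
apply: filterS aeqw => t + t0 => /(_ t0)[v [_ [_ _ dw0 dw1]]].
exists (- (2 * k) * ((q0 t * w1 t - q1 t * w0 t) ^+ 2 / (q0 t ^+ 2 + q1 t ^+ 2))).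
  apply: (is_derive_eq (is_derive1D (is_derive1M dw0 dw0) (is_derive1M dw1 dw1))).
  rewrite sqr_sqrtr ?ltW ?Q0//; field.
  by rewrite gt_eqF// Q0.
rewrite oppr0 mul0r mulNr oppr_le0 mulr_ge0//; first lra.
by rewrite divr_ge0 ?sqr_ge0// ltW// Q0.
Qed.

(** The error never exceeds its initial norm [W], so the estimated distance is at least [d - W] and
    the radial speed at most [- kc * (d - W - ds)], inward beyond radius [W + ds]. *)
Lemma planar_flow_radius_le (R : realType) (k kc ds cm cM : R)
    (q0 q1 w0 w1 : R -> R) : 0 < k -> 0 < kc ->
  planar_flow k kc ds cm cM q0 q1 w0 w1 ->
  forall t, 0 <= t -> q0 t ^+ 2 + q1 t ^+ 2 <=
    (Num.sqrt (w0 0 ^+ 2 + w1 0 ^+ 2) + ds) ^+ 2 + (q0 0 ^+ 2 + q1 0 ^+ 2).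
Proof.
move=> k0 kc0 fl t t0.
have wle := planar_flow_error_le k0 fl; have [acqw Q0 aeqw] := fl.
set W := Num.sqrt (w0 0 ^+ 2 + w1 0 ^+ 2).
pose f s := q0 s * q0 s + q1 s * q1 s - (W + ds) ^+ 2.
have : f t <= f 0 * expR (- kc * t).
  apply: ac_gronwall t t0.
    move=> b b0; have [ac0 ac1 _ _] := acqw b b0.
    apply: ac_onB (ac_on_cst _ _ _).
    by apply: ac_onD; apply: ac_onM => //; exact: ltW.
  apply: filterS aeqw => t + t0 => /(_ t0)[v [_ []]].
  have := Q0 t t0; set Q := q0 t ^+ 2 + q1 t ^+ 2 => Qt.
  set d := Num.sqrt Q; set h := Num.sqrt _ => dq0 dq1 _ _.
  have d0 : 0 < d by rewrite sqrtr_gt0.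
  have dQ : Q = d ^+ 2 by rewrite sqr_sqrtr// ltW.
  exists (2 * (- kc * (h - ds)) * d).
    apply: (is_derive_eq (is_derive1B (is_derive1D (is_derive1M dq0 dq0)
      (is_derive1M dq1 dq1)) (is_derive_cst _ _ _))).
    transitivity (2 * (- kc * (h - ds)) * Q / d); first by rewrite /Q; ring.
    by rewrite dQ; field; rewrite gt_eqF.
  have dh : d <= h + W.
    apply: (@le_trans _ _ (h + Num.sqrt (w0 t ^+ 2 + w1 t ^+ 2))).
      apply: le_trans (sqrt_sum2_triangle _ _ _ _).
      by rewrite !subrK.
    by rewrite lerD2l ler_wsqrtr// wle.
  have -> : f t = d ^+ 2 - (W + ds) ^+ 2 by rewrite -dQ /f /Q -!expr2.
  have kd : 0 <= kc * d by rewrite mulr_ge0 ?ltW.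
  have h1 : kc * d * (d - W - ds) <= kc * d * (h - ds).
    by apply: ler_wpM2l => //; lra.
  (* This square is the gap between [2 d (d - c)] and [d^2 - c^2] for [c = W + ds], up to the factor
     [kc]. *)
  have h2 : 0 <= kc * (d - (W + ds)) ^+ 2 by rewrite mulr_ge0 ?sqr_ge0 ?ltW.
  nra.
rewrite /f -!expr2.
have e1 : expR (- kc * t) <= 1.
  by rewrite -expR0 ler_expR mulNr oppr_le0 mulr_ge0// ltW.
have e0 := expR_gt0 (- kc * t).
have h0 : 0 <= (W + ds) ^+ 2 by exact: sqr_ge0.
have h3 := Q0 0 (lexx 0).
(* The squared radius is at most a convex combination of [(W + ds) ^+ 2] and its initial value,
   hence at most their sum. *)
nra.
Qed.

(** * Lyapunov function and exponential decay *)

(** Rotation supplies [- 2 eps cm a^2]. Young's inequality spends half of it on the cross term, and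
    the resulting excess in [b^2] uses at most half of the damping [2 k b^2]. *)
Lemma lyapunov_rate_le (R : realType) (k cm cM v m M eps a b : R) :
  0 < cm -> cm <= v <= cM -> `|m| <= M -> 0 <= eps ->
  eps * (2 * cM + M ^+ 2 / cm) <= k ->
  - (2 * k) * b ^+ 2 + 2 * eps * (v * (b ^+ 2 - a ^+ 2) + m * (a * b)) <=
  - (eps * cm) * a ^+ 2 - k * b ^+ 2.
Proof.
move=> cm0 /andP[cmv vcM] mM eps0 epsk.
have young : 2 * (m * (a * b)) <= cm * a ^+ 2 + M ^+ 2 / cm * b ^+ 2.
  have h1 : 2 * (m * (a * b)) <= cm * a ^+ 2 + m ^+ 2 / cm * b ^+ 2.
    rewrite -subr_ge0.
    have -> : cm * a ^+ 2 + m ^+ 2 / cm * b ^+ 2 - 2 * (m * (a * b)) =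
        (cm * a - m * b) ^+ 2 / cm by field; rewrite gt_eqF.
    by rewrite divr_ge0 ?sqr_ge0// ltW.
  apply: le_trans h1 _; rewrite lerD2l ler_wpM2r ?sqr_ge0// ler_wpM2r//.
    by rewrite invr_ge0 ltW.
  by rewrite -[m ^+ 2]real_normK ?num_real// ler_sqr ?nnegrE// (le_trans _ mM).
have hv1 : v * b ^+ 2 <= cM * b ^+ 2 by rewrite ler_wpM2r ?sqr_ge0.
have hv2 : cm * a ^+ 2 <= v * a ^+ 2 by rewrite ler_wpM2r ?sqr_ge0.
have hk : eps * (2 * cM + M ^+ 2 / cm) * b ^+ 2 <= k * b ^+ 2.
  by rewrite ler_wpM2r ?sqr_ge0.
have : eps * (2 * (v * b ^+ 2) - 2 * (v * a ^+ 2) + 2 * (m * (a * b))) <=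
    eps * (2 * (cM * b ^+ 2) - 2 * (cm * a ^+ 2) +
           (cm * a ^+ 2 + M ^+ 2 / cm * b ^+ 2)).
  by apply: ler_wpM2l => //; lra.
lra.
Qed.

Lemma planar_flow_error_exp (R : realType) (k kc ds cm cM : R)
    (q0 q1 w0 w1 : R -> R) : 0 < k -> 0 < kc -> 0 < ds -> 0 < cm -> cm <= cM ->
  planar_flow k kc ds cm cM q0 q1 w0 w1 ->
  exists C lambda, [/\ 0 < C, 0 < lambda & forall t, 0 <= t ->
    Num.sqrt (w0 t ^+ 2 + w1 t ^+ 2) <= C * expR (- lambda * t)].
Proof.
move=> k0 kc0 ds0 cm0 cmM fl.
have wle := planar_flow_error_le k0 fl.
have qle := planar_flow_radius_le k0 kc0 fl.
have [acqw Q0 aeqw] := fl.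
pose S t := w0 t ^+ 2 + w1 t ^+ 2.
pose W := Num.sqrt (S 0).
pose D := Num.sqrt ((W + ds) ^+ 2 + (q0 0 ^+ 2 + q1 0 ^+ 2)).
pose d t := Num.sqrt (q0 t * q0 t + q1 t * q1 t).
(* A / d and B / d are the components of w along q and along its
   counterclockwise normal, i.e. - a and b in the notation of the header. *)
pose A t := q0 t * w0 t + q1 t * w1 t.
pose B t := q0 t * w1 t - q1 t * w0 t.
(* Bounds [|u - k * d|], given [d <= D] and an estimated distance of at most [D + W]. *)
pose M := kc * (D + W + ds) + k * D.
(* The first two terms of the denominator give the hypothesis of [lyapunov_rate_le]; [2 * k * D]
   gives [eps * D <= 1 / 2], which keeps [V] comparable to [S]. *)
pose eps := k / (2 * cM + M ^+ 2 / cm + 2 * k * D + 1).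
have W0 : 0 <= W by exact: sqrtr_ge0.
have D0 : 0 <= D by exact: sqrtr_ge0.
have S0 t : 0 <= S t by rewrite addr_ge0 ?sqr_ge0.
have kD0 : 0 <= k * D by rewrite mulr_ge0// ltW.
have M20 : 0 <= M ^+ 2 / cm by rewrite divr_ge0 ?sqr_ge0// ltW.
have den0 : 0 < 2 * cM + M ^+ 2 / cm + 2 * k * D + 1 by lra.
have eps0 : 0 < eps by rewrite divr_gt0.
have epsden : eps * (2 * cM + M ^+ 2 / cm + 2 * k * D + 1) = k.
  by rewrite /eps divfK// gt_eqF.
have epsk : eps * (2 * cM + M ^+ 2 / cm) <= k.
  by rewrite -[leRHS]epsden; apply: ler_wpM2l; [exact: ltW|lra].
have epsD : eps * D <= 1 / 2.
  rewrite -(ler_pM2l k0) -[X in _ <= X * _]epsden.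
  have : 0 <= eps * (2 * cM + M ^+ 2 / cm + 1) by rewrite mulr_ge0 ?ltW//; lra.
  lra.
have d0 t : 0 <= t -> 0 < d t.
  by move=> t0; rewrite sqrtr_gt0 -!expr2 Q0.
have d2 t : d t ^+ 2 = q0 t ^+ 2 + q1 t ^+ 2.
  by rewrite sqr_sqrtr -!expr2// addr_ge0 ?sqr_ge0.
have dD t : 0 <= t -> d t <= D.
  by move=> t0; rewrite ler_wsqrtr// -!expr2 qle.
have ABS t : A t ^+ 2 + B t ^+ 2 = d t ^+ 2 * S t.
  by rewrite d2 /A /B /S; ring.
have abS t : 0 <= t -> (A t / d t) ^+ 2 + (B t / d t) ^+ 2 = S t.
  move=> t0; rewrite !expr_div_n -mulrDl ABS mulrC mulKf//.
  by rewrite expf_neq0// gt_eqF// d0.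
pose V t := w0 t * w0 t + w1 t * w1 t + 2 * eps * (A t * B t * (d t)^-1).
have VE t : 0 <= t -> V t = S t + 2 * eps * d t * ((A t / d t) * (B t / d t)).
  move=> t0; rewrite /V /S !expr2; congr (_ + _); field.
  by rewrite gt_eqF// d0.
(* As [2 |a b| <= a^2 + b^2], the cross term is at most [eps * d t * S t], hence at most half of
   [S t]. *)
have VS t : 0 <= t -> S t / 2 <= V t <= 3 / 2 * S t.
  move=> t0; rewrite VE//.
  have := abS t t0; set a := A t / d t; set b := B t / d t => abSt.
  have epsd : eps * d t <= 1 / 2.
    by apply: le_trans epsD; rewrite ler_wpM2l ?dD// ltW.
  have ed0 : 0 <= eps * d t by rewrite mulr_ge0// ltW// d0.
  have h1 : 0 <= eps * d t * (a + b) ^+ 2 by rewrite mulr_ge0 ?sqr_ge0.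
  have h2 : 0 <= eps * d t * (a - b) ^+ 2 by rewrite mulr_ge0 ?sqr_ge0.
  have h3 : eps * d t * S t <= 1 / 2 * S t by rewrite ler_wpM2r.
  by apply/andP; split; rewrite -abSt in h3 *; lra.
pose mu := Num.min (eps * cm) k.
have mu0 : 0 < mu by rewrite lt_min mulr_gt0.
have mu1 : mu <= eps * cm by rewrite ge_min lexx.
have mu2 : mu <= k by rewrite ge_min lexx orbT.
(* The derivative of [V] is at most [- mu * S], and [S >= 2 / 3 * V]. *)
have Vle : forall t, 0 <= t -> V t <= V 0 * expR (- (2 / 3 * mu) * t).
  apply: ac_gronwall.
    move=> b b0; have b0' := ltW b0; have [a1 a2 a3 a4] := acqw b b0.
    apply: ac_onD; first by apply: ac_onD; apply: ac_onM.
    apply: ac_onM (ac_on_cst _ _ _) _ => //.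
    apply: ac_onM => //.
      by apply: ac_onM => //; [apply: ac_onD|apply: ac_onB]; apply: ac_onM.
    apply: ac_onV => // [|t t0 _]; last exact: d0.
    apply: ac_on_sqrt => // [|t t0 _]; last by rewrite -!expr2 Q0.
    by apply: ac_onD; apply: ac_onM.
  apply: filterS aeqw => t + t0 => /(_ t0)[v].
  set u := - kc * _; rewrite -d2 sqrtr_sqr ger0_norm ?(ltW (d0 t t0))//.
  have dt0 := d0 t t0.
  move=> [vcM [dq0 dq1 dw0 dw1]].
  pose a := A t / d t; pose b := B t / d t.
  exists (- (2 * k) * b ^+ 2 +
      2 * eps * (v * (b ^+ 2 - a ^+ 2) + (u - k * d t) * (a * b))).
    have Qpos : 0 < q0 t * q0 t + q1 t * q1 t by rewrite -!expr2 Q0.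
    have dtn0 : d t != 0 by rewrite gt_eqF.
    have dQ : is_derive t 1 (fun s => q0 s * q0 s + q1 s * q1 s) (2 * u * d t).
      apply: (is_derive_eq (is_derive1D (is_derive1M dq0 dq0) (is_derive1M dq1 dq1))).
      transitivity (2 * u * (q0 t ^+ 2 + q1 t ^+ 2) / d t); first by ring.
      by rewrite -d2; field.
    have dd : is_derive t 1 d u.
      apply: (is_derive_eq (@is_derive1_sqrt_comp _
        (fun s => q0 s * q0 s + q1 s * q1 s) t _ Qpos dQ)).
      by rewrite -/(d t); field.
    (* The velocity of [w] is orthogonal to [q]: it contributes nothing to [A], and [- k * B] to
       [B]. *)
    have dA : is_derive t 1 A ((u * A t + v * B t) / d t).
      apply: (is_derive_eq (is_derive1D (is_derive1M dq0 dw0) (is_derive1M dq1 dw1))).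
      by rewrite /A /B; field.
    have dB : is_derive t 1 B ((u * B t - v * A t) / d t - k * B t).
      apply: (is_derive_eq (is_derive1B (is_derive1M dq0 dw1) (is_derive1M dq1 dw0))).
      transitivity ((u * B t - v * A t) / d t -
        k * B t * (q0 t ^+ 2 + q1 t ^+ 2) / d t ^+ 2).
        by rewrite /A /B; field.
      by rewrite -d2; field.
    have dS := is_derive1D (is_derive1M dw0 dw0) (is_derive1M dw1 dw1).
    apply: (is_derive_eq (is_derive1D dS (is_derive1M (is_derive_cst (2 * eps) t 1)
        (is_derive1M (is_derive1M dA dB) (is_derive1V dtn0 dd))))).
    transitivity (- (2 * k) * (B t / d t) ^+ 2 + 2 * eps * (((u * A t + v * B t) / d t * B t
       + A t * ((u * B t - v * A t) / d t - k * B t)) / d t - A t * B t * u / d t ^+ 2)).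
      by rewrite /cst /A /B; field.
    by rewrite /a /b; field.
  have uM : `|u - k * d t| <= M.
    have hle : Num.sqrt ((q0 t - w0 t) ^+ 2 + (q1 t - w1 t) ^+ 2) <= D + W.
      apply: le_trans (sqrt_sum2_triangle _ _ _ _) _; rewrite !sqrrN -d2.
      rewrite sqrtr_sqr ger0_norm ?(ltW dt0)// lerD ?dD//.
      by rewrite ler_wsqrtr// wle.
    rewrite (le_trans (ler_normB _ _))// lerD//.
      rewrite /u normrM normrN (gtr0_norm kc0) ler_wpM2l ?(ltW kc0)//.
      rewrite (le_trans (ler_normB _ _))// (gtr0_norm ds0) ger0_norm ?sqrtr_ge0//.
      by rewrite lerD2r.
    by rewrite gtr0_norm ?mulr_gt0// ler_wpM2l ?dD// ltW.
  apply: (le_trans (lyapunov_rate_le a b cm0 vcM uM (ltW eps0) epsk)).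
  have /andP[_ V2] := VS t t0.
  have h1 : mu * a ^+ 2 <= eps * cm * a ^+ 2 by rewrite ler_wpM2r ?sqr_ge0.
  have h2 : mu * b ^+ 2 <= k * b ^+ 2 by rewrite ler_wpM2r ?sqr_ge0.
  have h3 : mu * V t <= mu * (3 / 2 * (a ^+ 2 + b ^+ 2)).
    by rewrite abS// ler_wpM2l// ltW.
  lra.
(* From [S <= 2 V] and [V 0 <= 3 / 2 * S 0]; the square root halves the rate, and [+ 1] keeps the
   constant positive when the initial error is zero. *)
exists (Num.sqrt (3 * S 0) + 1), (mu / 3); split.
- by rewrite ltr_wpDl// sqrtr_ge0.
- lra.
move=> t t0.
have /andP[V1 _] := VS t t0; have /andP[_ V2] := VS 0 (lexx 0).
set e := expR _.
have e0 : 0 < e by exact: expR_gt0.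
have e2 : expR (- (2 / 3 * mu) * t) = e ^+ 2.
  by rewrite /e expr2 -expRD; congr expR; field.
have S0e : S t <= 3 * S 0 * e ^+ 2.
  have := Vle t t0; rewrite e2 => h.
  have : V 0 * e ^+ 2 <= 3 / 2 * S 0 * e ^+ 2 by rewrite ler_wpM2r// sqr_ge0.
  lra.
apply: (@le_trans _ _ (Num.sqrt (3 * S 0) * e)).
  apply: le_trans (ler_wsqrtr S0e) _.
  by rewrite sqrtrM ?mulr_ge0// sqrtr_sqr ger0_norm// ltW.
by rewrite ler_wpM2r ?ltW// ltrDl.
Qed.

(** * From the vector equations to coordinates *)

Lemma sum_ord2 (R : realType) (F : 'I_2 -> R) : \sum_i F i = F 0 + F 1.
Proof.
rewrite !big_ord_recl big_ord0 addr0; congr (_ + F _).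
exact/val_inj.
Qed.

Lemma enormE (R : realType) (v : 'cV[R]_2) :
  enorm v = Num.sqrt (v 0 0 ^+ 2 + v 1 0 ^+ 2).
Proof. by rewrite /enorm sum_ord2. Qed.

Lemma ler_coord_enorm (R : realType) (v : 'cV[R]_2) (i : 'I_2) :
  `|v i 0| <= enorm v.
Proof.
rewrite /enorm (bigD1 i)//= -sqrtr_sqr ler_wsqrtr// lerDl.
by apply: sumr_ge0 => j _; exact: sqr_ge0.
Qed.

Lemma abs_continuous_coord (R : realType) (f : R -> 'cV[R]_2) (a b : R)
    (i : 'I_2) : abs_continuous f a b -> ac_on (fun t => f t i 0) a b.
Proof.
move=> acf eps /acf[delta delta0 hd]; exists delta => // m s e se tI sd.
apply: le_lt_trans (hd m s e se tI sd); apply: ler_sum => k _.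
by have := ler_coord_enorm (f (e k) - f (s k)) i; rewrite !mxE.
Qed.

Lemma is_derive_coord (R : realType) (m n : nat) (M : R -> 'M[R]_(m, n))
    (t : R) (dM : 'M[R]_(m, n)) (i : 'I_m) (j : 'I_n) :
  is_derive t 1 M dM -> is_derive t 1 (fun s => M s i j) (dM i j).
Proof.
move=> [dvM dME]; apply: DeriveDef; first exact: (derivable_mxP M t 1).1.
by rewrite -dME derive_mx// mxE.
Qed.

(** The default value [0] of [xget] lies in the same range as a genuine angle. *)
Lemma ccw_angle_itv (R : realType) (u v : 'cV[R]_2) :
  0 <= ccw_angle u v < 2 * pi.
Proof.
rewrite /ccw_angle; case: xgetP => [a _ []//|_].
by rewrite lexx mulr_gt0// pi_gt0.
Qed.

(** [beta_hat] ranges in [-pi, 3 pi[. This uniform bound makes the [sup] in the condition on [alpha]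
    a genuine upper bound. *)
Lemma norm_beta_tilde_le (R : realType) (n : nat) (x : 'cV[R]_2)
    (betas : 'I_n -> R) (p : 'I_n -> R -> 'cV[R]_2) (i : 'I_n) (t : R) :
  0 <= betas i < 2 * pi -> `|beta_tilde x betas p i t| <= 3 * pi.
Proof.
move=> /andP[b0 b2]; rewrite /beta_tilde /beta_hat.
have := ccw_angle_itv (bearing (p i t) x)
  (bearing (p i t) (p (neighbor i) t)); rewrite -/(psi x p i t).
have := pi_gt0 R; move=> pi0 /andP[psi0 psi2].
by rewrite ler_norml; case: (leP pi (psi x p i t)) => h; apply/andP; split; lra.
Qed.

(** The bearing is [- q / d]: the radial gain changes sign, and the clockwise normal of the bearing
    is the counterclockwise normal of [q]. *)
Lemma controllerE (R : realType) (n : nat) (x : 'cV[R]_2)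
    (kc komega ds alpha : R) (betas : 'I_n -> R)
    (p xhat : 'I_n -> R -> 'cV[R]_2) (i : 'I_n) (t : R) :
  let q j := p i t j 0 - x j 0 in
  let w j := xhat i t j 0 - x j 0 in
  let d := Num.sqrt (q 0 ^+ 2 + q 1 ^+ 2) in
  let u := - kc * (Num.sqrt ((q 0 - w 0) ^+ 2 + (q 1 - w 1) ^+ 2) - ds) in
  let v := komega * (alpha + beta_tilde x betas p i t) in
  let c := controller x kc komega ds alpha betas p xhat i t in
  c 0 0 = (u * q 0 - v * q 1) / d /\ c 1 0 = (u * q 1 + v * q 0) / d.
Proof.
move=> q w d u v c.
have dE : enorm (x - p i t) = d.
  rewrite enormE !mxE /d /q; congr Num.sqrt.
  by rewrite -[X in X ^+ 2 + _]opprB -[X in _ + X ^+ 2]opprB !sqrrN.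
have hE : enorm (p i t - xhat i t) =
    Num.sqrt ((q 0 - w 0) ^+ 2 + (q 1 - w 1) ^+ 2).
  by rewrite enormE !mxE /q /w; congr Num.sqrt; ring.
rewrite /c /controller /rot /bearing !mxE /= dE hE cosN sinN cos_pihalf
  sin_pihalf.
by rewrite -/v /u /q; split; ring.
Qed.

(** The projector kills [q], so of [p - xhat = q - w] only the normal component of [- w] remains. *)
Lemma estimatorE (R : realType) (n : nat) (x : 'cV[R]_2) (kest : R)
    (p xhat : 'I_n -> R -> 'cV[R]_2) (i : 'I_n) (t : R) :
  let q j := p i t j 0 - x j 0 in
  let w j := xhat i t j 0 - x j 0 in
  let d := Num.sqrt (q 0 ^+ 2 + q 1 ^+ 2) in
  let z := kest * (q 0 * w 1 - q 1 * w 0) / d ^+ 2 in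
  let c := estimator x kest p xhat i t in
  0 < enorm (x - p i t) -> c 0 0 = z * q 1 /\ c 1 0 = - z * q 0.
Proof.
move=> q w d z c.
have dE : enorm (x - p i t) = d.
  rewrite enormE !mxE /d /q; congr Num.sqrt.
  by rewrite -[X in X ^+ 2 + _]opprB -[X in _ + X ^+ 2]opprB !sqrrN.
rewrite dE => d0.
have Q0 : 0 < q 0 ^+ 2 + q 1 ^+ 2 by rewrite -sqrtr_gt0.
have d2 : d ^+ 2 = q 0 ^+ 2 + q 1 ^+ 2 by rewrite sqr_sqrtr// ltW.
have dn0 : d != 0 by rewrite gt_eqF.
rewrite /c /estimator /bearing !mxE !sum_ord2 !mxE !big_ord1 !mxE /= dE.
have E0 : x 0 0 - p i t 0 0 = - q 0 by rewrite opprB.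
have E1 : x 1 0 - p i t 1 0 = - q 1 by rewrite opprB.
have F0 : p i t 0 0 - xhat i t 0 0 = q 0 - w 0 by rewrite /q /w; ring.
have F1 : p i t 1 0 - xhat i t 1 0 = q 1 - w 1 by rewrite /q /w; ring.
rewrite E0 E1 F0 F1 /z mulr1n mulr0n; split.
  transitivity (kest * (d ^+ 2 * (q 0 - w 0) - q 0 ^+ 2 * (q 0 - w 0)
      - q 0 * q 1 * (q 1 - w 1)) / d ^+ 2); first by field.
  by rewrite {1}d2; field.
transitivity (kest * (d ^+ 2 * (q 1 - w 1) - q 1 ^+ 2 * (q 1 - w 1)
    - q 0 * q 1 * (q 0 - w 0)) / d ^+ 2); first by field.
by rewrite {1}d2; field.
Qed.

Unset Implicit Arguments.

Theorem mainTheorem1 (R : realType) (n : nat) (hn : (2 <= n)%N)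
  (x : 'cV[R]_2) (kest kc komega ds alpha kappa : R) (betas : 'I_n -> R)
  (p xhat : 'I_n -> R -> 'cV[R]_2)
  (hkest : 0 < kest) (hkc : 0 < kc) (hkomega : 0 < komega) (hds : 0 < ds)
  (hbetas : forall i : 'I_n, 0 <= betas i < 2 * pi)
  (hinit_agents : forall i j : 'I_n, i <> j -> p i 0 <> p j 0)
  (hinit_target : forall i : 'I_n, p i 0 <> x)
  (hno_collision : forall (i j : 'I_n) (t : R),
     i <> j -> 0 <= t -> p i t <> p j t)
  (hsol : is_solution x kest kc komega ds alpha betas p xhat)
  (hkappa : 0 < kappa)
  (halpha : kappa <= alpha - sup [set b : R | exists (i : 'I_n) (t : R),
     0 <= t /\ b = `|beta_tilde x betas p i t|]) :
  forall i : 'I_n, exists C lambda : R,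
    [/\ 0 < C, 0 < lambda &
        forall t : R, 0 <= t ->
          enorm (xhat i t - x) <= C * expR (- lambda * t)].
Proof.
move=> i; have [acp acxhat aep aexhat dpos] := hsol i.
have betale t : 0 <= t -> `|beta_tilde x betas p i t| <= alpha - kappa.
  move=> t0; set T := (X in sup X) in halpha.
  have : `|beta_tilde x betas p i t| <= sup T.
    apply: ub_le_sup; last by exists i, t.
    by exists (3 * pi) => _ [j [s [_ ->]]]; exact: norm_beta_tilde_le.
  by move: halpha; lra.
have ak0 : 0 <= alpha - kappa by apply: le_trans (betale 0 _).
pose q j t := p i t j 0 - x j 0.
pose w j t := xhat i t j 0 - x j 0.
(* By [betale], [alpha + beta_tilde] lies between [kappa] and [2 * alpha - kappa], which yields both
   bounds on the angular gain. *)
have [|||C [lambda [C0 l0 hC]]] := @planar_flow_error_exp R kest kc ds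
  (komega * kappa) (komega * (2 * alpha)) (q 0) (q 1) (w 0) (w 1)
  hkest hkc hds.
- exact: mulr_gt0.
- by rewrite ler_wpM2l ?ltW//; lra.
- split.
  + by move=> b b0; split; apply: ac_onB (ac_on_cst _ _ _);
      apply: abs_continuous_coord; [exact: acp..|exact: acxhat|exact: acxhat].
  + move=> t t0; have := dpos t t0; rewrite enormE sqrtr_gt0 !mxE.
    by rewrite -[X in X ^+ 2 + _]opprB -[X in _ + X ^+ 2]opprB !sqrrN.
  + apply: filterS2 aep aexhat => t hp hx t0; have dp := hp t0; have dx := hx t0.
    exists (komega * (alpha + beta_tilde x betas p i t)).
    have [c0 c1] := controllerE x kc komega ds alpha betas p xhat i t.
    have [e0 e1] := estimatorE kest xhat (dpos t t0).
    have dB (M : R -> 'cV[R]_2) dM j : is_derive t 1 M dM ->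
        is_derive t 1 (fun s => M s j 0 - x j 0) (dM j 0).
      move=> dM'; apply: (is_derive_eq (is_derive1B (is_derive_coord j 0 dM')
        (is_derive_cst _ _ _))).
      exact: subr0.
    split.
      have := betale t t0; rewrite ler_norml => /andP[b1 b2].
      by apply/andP; split; rewrite ler_pM2l//; lra.
    split; rewrite -?c0 -?c1 -?e0 -?e1; exact: dB.
exists C, lambda; split=> // t t0.
by rewrite enormE !mxE; exact: hC.
Qed.
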